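(* Let $G_0 \xleftarrow{\varphi_0} G_1 \xleftarrow{\varphi_1} G_2 \xleftarrow{\varphi_2}\cdots$ be a sequence of covers of graphs, with inverse limit $(X,f)$, and suppose that $(X,f)$ is a Cantor system (i.e. $X$ is homeomorphic to the Cantor set). Then the following are mutually equivalent: 1. $(X,f)$ is minimal. 2. For all $n \in \mathbb{N}$ there exist $N > n$ and $l \ge 1$ such that for all $m \ge N$ and all $w \in W(G_m,l)$, $E_n(w) = E_n$. 3. For all $n \in \mathbb{N}$ there exist $N > n$ and $l \ge 1$ such that for all $m \ge N$ and all $w \in W(G_m,l)$, $V_n(w) = V_n$. 4. For all $n \in \mathbb{N}$ there exists $N > n$ such that for all $m \ge N$ and all $c \in \mathrm{Circ}(G_m)$, $E_n(c) = E_n$. 5. For all $n \in \mathbb{N}$ there exists $N > n$ such that for all $m \ge N$ and all $c \in \mathrm{Circ}(G_m)$, $V_n(c) = V_n$. 6. For all $n \in \mathbb{N}$ there exists $N > n$ such that for all $m \ge N$ there exists $l_m \ge 1$ such that for all $w \in W(G_m,l_m)$, $E_n(w) = E_n$. 7. For all $n \in \mathbb{N}$ there exists $N > n$ such that for all $m \ge N$ there exists $l_m \ge 1$ such that for all $w \in W(G_m,l_m)$, $V_n(w) = V_n$.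
   Context: $\mathbb{N}$ denotes the non-negative integers. A graph is a pair $G=(V,E)$ with $V$ a finite set and $E \subseteq V\times V$ a surjective relation: for each $v\in V$ there are edges $(u_1,v),(v,u_2)\in E$. A graph homomorphism $\varphi:(V_1,E_1)\to(V_2,E_2)$ is a map $\varphi:V_1\to V_2$ with $(\varphi\times\varphi)(E_1)\subseteq E_2$. It is a cover if it is edge-surjective, $(\varphi\times\varphi)(E_1)=E_2$, and $+$directional: $(u,v),(u,v')\in E_1$ implies $\varphi(v)=\varphi(v')$. In a sequence of covers $G_0 \xleftarrow{\varphi_0} G_1 \xleftarrow{\varphi_1}\cdots$, write $G_n=(V_n,E_n)$; each $\varphi_n:G_{n+1}\to G_n$ is a cover and $G_0=(\{0\},\{(0,0)\})$. For $m>n$, $\varphi_{m,n}:=\varphi_n\circ\varphi_{n+1}\circ\cdots\circ\varphi_{m-1}$. The inverse limit $(X,f)$ is: $X=\{(x_0,x_1,\dots)\in\prod_i V_i : x_i=\varphi_i(x_{i+1})\ \forall i\}$ with the product topology (each $V_i$ discrete), which is compact, metrizable and 0-dimensional, and $f:X\to X$ is the continuous surjection whose graph is $\{(x,y)\in X\times X: (x_i,y_i)\in E_i\ \forall i\}$. A walk of length $l\ge1$ in $G=(V,E)$ is a sequence $w=(v_0,\dots,v_l)$ with $(v_i,v_{i+1})\in E$ for $0\le i<l$; $W(G,l)$ is the set of walks of length $l$. $V(w)=\{v_0,\dots,v_l\}$, $E(w)=\{(v_i,v_{i+1}):0\le i<l\}$. A circuit is a walk with $v_0=v_l$ and $v_0,\dots,v_{l-1}$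 pairwise distinct, regarded as a subgraph $c$ of $G$ with vertex set $V(c)$ and edge set $E(c)$ ($l$ vertices, $l$ edges); $\mathrm{Circ}(G)$ is the set of all circuits of $G$. For $m>n$ and a walk $w$ in $G_m$ (resp. $c\in\mathrm{Circ}(G_m)$), $V_n(w):=\varphi_{m,n}(V(w))\subseteq V_n$ and $E_n(w):=(\varphi_{m,n}\times\varphi_{m,n})(E(w))\subseteq E_n$, and likewise $V_n(c)$, $E_n(c)$. $(X,f)$ is minimal if there is no closed subset $\emptyset\ne Y\subsetneq X$ with $f(Y)=Y$. *)

(* Defs.v *)
From mathcomp Require Import all_boot.
From mathcomp Require Import all_classical.
From mathcomp Require Import topology cantor.

Set Implicit Arguments.
Unset Strict Implicit.
Unset Printing Implicit Defensive.

Record graph := Graph {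
  vertex :> finType;
  edges : {set vertex * vertex};
  edges_surj : forall v : vertex,
    (exists u, (u, v) \in edges) /\ (exists u, (v, u) \in edges) }.

Definition edge_map (T1 T2 : Type) (phi : T1 -> T2) (e : T1 * T1) : T2 * T2 :=
  (phi e.1, phi e.2).

Definition graph_hom (G1 G2 : graph) (phi : G1 -> G2) : Prop :=
  edge_map phi @: edges G1 \subset edges G2.

Definition edge_surjective (G1 G2 : graph) (phi : G1 -> G2) : Prop :=
  edge_map phi @: edges G1 = edges G2.

Definition plus_directional (G1 G2 : graph) (phi : G1 -> G2) : Prop :=
  forall u v v' : G1,
    (u, v) \in edges G1 -> (u, v') \in edges G1 -> phi v = phi v'.

Definition graph_cover (G1 G2 : graph) (phi : G1 -> G2) : Prop :=
  [/\ graph_hom phi, edge_surjective phi & plus_directional phi].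

(* The zeroth graph is ({0}, {(0, 0)}) up to the name of its vertex. *)
Record cover_seq := CoverSeq {
  graphs :> nat -> graph;
  bond : forall n, graphs n.+1 -> graphs n;
  bond_cover : forall n, graph_cover (@bond n);
  graph0 : exists o : graphs 0,
    [set: graphs 0] = [set o]%SET /\ edges (graphs 0) = [set (o, o)]%SET }.

Section Bonds.
Variable S : cover_seq.

Fixpoint bond_iter (n k : nat) : S (k + n) -> S n :=
  if k is k'.+1 then fun x => bond_iter (bond x) else id.

(* phi_{m,n} = phi_n \o phi_{n+1} \o ... \o phi_{m-1}; the equations
   bondsS and bonds_step below characterize it. *)
Definition bonds (n m : nat) (nm : n < m) (x : S m) : S n :=
  @bond_iter n (m - n) (ecast i (S i) (esym (subnK (ltnW nm))) x).

Lemma bond_iter_cast n k (x : S (k + n)) j (e : k + n = j + n) :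
  @bond_iter n j (ecast i (S i) e x) = bond_iter x.
Proof.
have ekj : k = j by move/addIn: e.
by case: _ / ekj e => e; rewrite eq_axiomK.
Qed.

Lemma bondsS n (nn1 : n < n.+1) (x : S n.+1) : bonds nn1 x = bond x.
Proof.
rewrite /bonds; have e1 : 1 + n = (n.+1 - n) + n by rewrite subSnn.
by rewrite (eq_irrelevance (esym _) e1) (@bond_iter_cast n 1).
Qed.

Lemma bonds_step n m (nm : n < m) (nm1 : n < m.+1) (x : S m.+1) :
  bonds nm1 x = bonds nm (bond x).
Proof.
rewrite /bonds; have [k ek] : exists k, m = k + n.
  by exists (m - n); rewrite subnK // ltnW.
case: _ / (esym ek) in nm nm1 x *.
have E1 (e : (k + n).+1 = ((k + n).+1 - n) + n) :
    @bond_iter n ((k + n).+1 - n) (ecast i (S i) e x) = @bond_iter n k.+1 x.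
  exact: (@bond_iter_cast n k.+1).
by rewrite E1 (@bond_iter_cast n k).
Qed.

End Bonds.

(* A walk (v_0, ..., v_l) has l.+1 entries. *)
Definition walks (G : graph) (l : nat) : {set l.+1.-tuple G} :=
  [set w : l.+1.-tuple G | sorted (fun u v => (u, v) \in edges G) w]%SET.

Definition walk_vertices (G : graph) (w : seq G) : {set G} :=
  [set v in w]%SET.

Definition walk_edges (G : graph) (w : seq G) : {set G * G} :=
  [set e in zip w (behead w)]%SET.

Definition is_circuit (G : graph) (l : nat) (w : l.+1.-tuple G) : Prop :=
  [/\ 1 <= l, w \in walks G l, tnth w ord0 = tnth w ord_max
    & uniq (take l w)].

(* A circuit is regarded as a subgraph, i.e. the pair (V(c), E(c)). *)
Definition Circ (G : graph) : set ({set G} * {set G * G}) :=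
  fun c => exists (l : nat) (w : l.+1.-tuple G),
    is_circuit w /\ c = (walk_vertices w, walk_edges w).
Arguments Circ : clear implicits.

Section Images.
Variables (S : cover_seq) (n m : nat).

Definition vertices_at (nm : n < m) (A : {set S m}) : {set S n} :=
  bonds nm @: A.

Definition edges_at (nm : n < m) (B : {set S m * S m}) : {set S n * S n} :=
  edge_map (bonds nm) @: B.

End Images.

Local Open Scope classical_set_scope.

Section InverseLimit.
Variable S : cover_seq.

Definition limit_set : set (prod_topology (fun n => discrete_topology (S n))) :=
  [set x | forall i, x i = @bond S i (x i.+1)].

(* The set viewed as a type carries the subspace topology. *)
Definition limit : topologicalType := set_type limit_set.

Definition coord (x : limit) (i : nat) : S i := set_val x i.

Definition limit_graph (x y : limit) : Prop :=
  forall i, (coord x i, coord y i) \in edges (S i).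

Lemma coord_bond (x : limit) i : coord x i = bond (coord x i.+1).
Proof. exact: (set_valP x i). Qed.

Lemma coord_inj (x y : limit) : (forall i, coord x i = coord y i) -> x = y.
Proof. by move=> xy; apply: val_inj; apply: functional_extensionality_dep. Qed.

Lemma limit_graph_total (x : limit) : exists y, limit_graph x y.
Proof.
have out i : {v | (coord x i, v) \in edges (S i)}.
  by apply: cid; have [_] := edges_surj (coord x i).
pose z i := bond (sval (out i.+1)).
have xz i : (coord x i, z i) \in edges (S i).
  have [_ eS _] := bond_cover S i.
  rewrite coord_bond -eS.
  by apply/imsetP; exists (coord x i.+1, sval (out i.+1)) => //; case: (out _).
have zL : limit_set z.
  move=> i; have [_ _ dir] := bond_cover S i.
  by apply: (dir (coord x i.+1)) => //; case: (out _).
by exists (exist _ (z : prod_topology _) (mem_set zL)).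
Qed.

Lemma limit_graph_functional (x y z : limit) :
  limit_graph x y -> limit_graph x z -> y = z.
Proof.
move=> xy xz; apply: coord_inj => i; have [_ _ dir] := bond_cover S i.
by rewrite (coord_bond y) (coord_bond z); apply: dir (xy _) (xz _).
Qed.

Definition limit_map (x : limit) : limit := sval (cid (limit_graph_total x)).

Lemma limit_mapP (x y : limit) : limit_map x = y <-> limit_graph x y.
Proof.
rewrite /limit_map; case: cid => z xz /=; split=> [<- //|xy].
exact: limit_graph_functional xz xy.
Qed.

End InverseLimit.

Definition homeomorphic (T U : topologicalType) : Prop :=
  exists (g : T -> U) (h : U -> T),
    [/\ cancel g h, cancel h g, continuous g & continuous h].

Definition minimal (T : topologicalType) (f : T -> T) : Prop :=
  ~ exists Y : set T,
      [/\ closed Y, Y !=set0, Y `<` [set: T] & f @` Y = Y].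

(* Main.v *)
Require Import Defs.
From mathcomp Require Import all_boot all_classical topology cantor.

(** The seven conditions are closed into a cycle in which only the first and the
last arrows involve the space [limit S]; the others compare walks and circuits
of finite graphs.

From minimality to long walks.  In a compact Hausdorff system a nonempty closed
forward invariant set contains a nonempty closed set [Y] with [f @` Y = Y], the
intersection of its forward images ([invariant_core]).  So in a minimal system
no forward orbit avoids a nonempty open set [U], and by compactness every point
enters [U] within a uniform time ([minimal_return_bounded]).  Applied to the
finitely many cylinders of level [n], this gives one [l] such that every orbit
segment of length [l] visits all the vertices of level [n].  An arbitrary walk
of [S m] need not be the trace of an orbit, but +directionality makes it one
after projection: each level dropped determines one more step of the walk from
its starting vertex, so a walk of length [l] in [S m] with [n + l < m] has the
same image in level [n] as an orbit segment ([walk_shadow]).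

From vertices to edges.  An edge of level [n] lifts to an edge [(a, b)] of level
[n.+1]; if a walk passes over [a] and does not stop there, +directionality
forces its next step to lie over the image of [b] in level [n].  Hence visiting
all the vertices of level [n.+1] implies traversing all the edges of level [n]
([edges_at_full]).

Between walks and circuits.  Following a circuit round and round gives walks of
any length inside it ([walks_visit_all_circuit_edges]); conversely a walk longer
than the number of vertices contains a circuit ([circuits_walks_visit_all]).

Back to minimality.  A proper closed invariant set misses a whole cylinder, and
then the trace in a higher level of an orbit inside it is an arbitrarily long
walk that misses a vertex ([walks_visit_all_minimal]). *)

Set Implicit Arguments.
Unset Strict Implicit.
Unset Printing Implicit Defensive.

Local Open Scope classical_set_scope.

(** * Minimal maps of compact Hausdorff spaces *)

(** Cantor's intersection theorem, as a cluster point of the filter generated by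
the sequence. *)
Lemma nested_closed_nonempty (T : topologicalType) (F : nat -> set T) :
  compact [set: T] -> (forall k, closed (F k)) -> (forall k, F k !=set0) ->
  (forall k, F k.+1 `<=` F k) -> \bigcap_k F k !=set0.
Proof.
move=> cT clF F0 FS.
have Fle i j : i <= j -> F j `<=` F i.
  move=> /subnK <-; elim: (j - i) => // k IH.
  exact: subset_trans (FS _) IH.
pose G := filter_from [set: nat] F.
have GF : ProperFilter G.
  apply: filter_from_proper => //; apply: filter_from_filter; first by exists 0.
  move=> i j _ _; exists (maxn i j) => // x Fx.
  by split; apply: Fle Fx; rewrite ?leq_maxl ?leq_maxr.
have [x [_ clx]] := cT G GF (ex_intro2 _ _ 0 I (fun _ _ => I)).
exists x => k _; apply: (clF k) => B nB.
by apply: clx => //; exists k.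
Qed.

Section CompactDynamics.
Variables (T : topologicalType) (f : T -> T).
Hypotheses (cT : compact [set: T]) (hT : hausdorff_space T)
  (cf : continuous f).

Lemma closed_image (A : set T) : closed A -> closed (f @` A).
Proof.
move=> clA; apply: compact_closed => //; apply: continuous_compact.
  exact: continuous_subspaceT.
exact: subclosed_compact clA cT _.
Qed.

Lemma continuous_iter k : continuous (iter k f).
Proof.
elim: k => [|k IH] x; first exact: cvg_id.
by apply: continuous_comp; [exact: IH | exact: cf].
Qed.

(** The intersection [Y] of the forward images of [Z] satisfies [f @` Y = Y]: the
preimages of a point of [Y] in the successive images of [Z] form a decreasing
sequence of nonempty closed sets, so they have a common point. *)
Lemma invariant_core (Z : set T) :
  closed Z -> Z !=set0 -> f @` Z `<=` Z ->
  exists Y, [/\ closed Y, Y !=set0, Y `<=` Z & f @` Y = Y].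
Proof.
move=> clZ Z0 fZ.
pose F k := iter k (fun A => f @` A) Z.
have clF k : closed (F k) by elim: k => //= k; exact: closed_image.
have F0 k : F k !=set0 by elim: k => //= k [x Fx]; exists (f x), x.
have FS k : F k.+1 `<=` F k.
  elim: k => //= k IH; exact: image_subset.
exists (\bigcap_k F k); split.
- exact: closed_bigI.
- exact: nested_closed_nonempty.
- by move=> x /(_ 0 I).
apply/seteqP; split=> [_ [x Fx <-] k _|y Fy].
  by apply: FS; exists x => //; apply: Fx.
have cly : closed (f @^-1` [set y]).
  apply: preimage_closed; first by move=> x _; apply: cf.
  exact: accessible_closed_set1 (hausdorff_accessible hT) y.
have [|k|k x [Fx fx]|x Px] := @nested_closed_nonempty T
  (fun k => F k `&` f @^-1` [set y]) cT.
- by move=> k; apply: closedI.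
- by have [x Fx <-] := Fy k.+1 I; exists x.
- by split=> //; apply: FS.
by exists x => [k _|]; [case: (Px k I) | case: (Px 0 I)].
Qed.

(** If no time bound works, the closed sets of the points that stay outside [U]
up to time [l] are nonempty and decrease with [l], so some orbit never enters
[U]; the points with this property contain an invariant core, which contradicts
minimality. *)
Lemma minimal_return_bounded (U : set T) :
  minimal f -> open U -> U !=set0 ->
  exists l, forall x, exists2 i, i <= l & U (iter i f x).
Proof.
move=> minf opU [u Uu]; apply: contrapT => noreturn.
have clpre i : closed (iter i f @^-1` ~` U).
  apply: preimage_closed; last exact: open_closedC.
  by move=> x _; apply: continuous_iter.
pose Z := \bigcap_i iter i f @^-1` ~` U.
have Z0 : Z !=set0.
  pose F l := \bigcap_(i in [set i | i <= l]) iter i f @^-1` ~` U.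
  have [||l x Fx|x Fx] := @nested_closed_nonempty T F cT.
  - by move=> l; exact: closed_bigI.
  - move=> l; apply: contrapT => F0; apply: noreturn; exists l => x.
    apply: contrapT => nx; apply: F0; exists x => i il Ux.
    by apply: nx; exists i.
  - by move=> i /= il; apply: Fx; apply: leqW.
  - by exists x => i _; apply: (Fx i I i) => /=.
have fZ : f @` Z `<=` Z.
  by move=> _ [x Zx <-] i _; rewrite /= -iterSr; apply: Zx i.+1 I.
have clZ : closed Z by apply: closed_bigI => i _.
have [Y [clY Y0 YZ fY]] := invariant_core clZ Z0 fZ.
apply: minf; exists Y; split=> //; split=> // /(_ u I) /YZ /(_ 0 I).
exact.
Qed.

End CompactDynamics.

Lemma homeomorphic_compact_hausdorff (T U : topologicalType) :
  homeomorphic T U -> compact [set: U] -> hausdorff_space U ->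
  compact [set: T] /\ hausdorff_space T.
Proof.
move=> [g [h [gK hK cg ch]]] cU hU; split.
  have -> : [set: T] = h @` [set: U].
    by apply/seteqP; split=> // x _; exists (g x).
  by apply: continuous_compact cU; exact: continuous_subspaceT.
move=> p q clpq; apply: (can_inj gK); apply: hU => A B nA nB.
have [x [Ax Bx]] := clpq _ _ (cg p _ nA) (cg q _ nB).
by exists (g x).
Qed.

(** * Cylinders and orbits in the inverse limit *)

Section Limit.
Variable S : cover_seq.
Implicit Types (x y : limit S) (n m i j k l : nat).

Lemma bonds_left n m (nm : n < m) (n1m : n.+1 < m) (u : S m) :
  bonds nm u = bond (bonds n1m u).
Proof.
elim: m nm n1m u => // m IH nm n1m u.
have [nm' | ] := boolP (n.+1 < m).
  by rewrite (bonds_step nm') (bonds_step (ltnW nm')); apply: IH.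
rewrite -leqNgt => mn; have mE : m = n.+1 by apply/eqP; rewrite eqn_leq mn.
by subst m; rewrite (bonds_step (ltnSn n)) !bondsS.
Qed.

Lemma coord_bonds n m (nm : n < m) x : bonds nm (coord x m) = coord x n.
Proof.
elim: m nm => // m IH nm.
have [nm' | ] := boolP (n < m); first by rewrite (bonds_step nm') -coord_bond.
rewrite -leqNgt => mn; have mE : m = n by apply/eqP; rewrite eqn_leq mn.
by subst m; rewrite bondsS -coord_bond.
Qed.

Lemma edge_bonds n m (nm : n < m) (u v : S m) :
  (u, v) \in edges (S m) -> (bonds nm u, bonds nm v) \in edges (S n).
Proof.
have edge_bond k (a b : S k.+1) :
    (a, b) \in edges (S k.+1) -> (bond a, bond b) \in edges (S k).
  move=> ab; have [_ <- _] := bond_cover S k.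
  by apply/imsetP; exists (a, b).
elim: m nm u v => // m IH nm u v uv.
have [nm' | ] := boolP (n < m).
  by rewrite !(bonds_step nm'); apply/IH/edge_bond.
rewrite -leqNgt => mn; have mE : m = n by apply/eqP; rewrite eqn_leq mn.
by subst m; rewrite !bondsS; exact: edge_bond.
Qed.

Lemma bond_surj n (v : S n) : exists u : S n.+1, bond u = v.
Proof.
have [[u uv] _] := edges_surj v; have [_ eS _] := bond_cover S n.
by move: uv; rewrite -eS => /imsetP[[a b] _ [_ ->]]; exists b.
Qed.

(** Choose preimages of [v] in all the levels [k + n]; the coordinates of the
point are their projections.  Coordinate [i] uses level [i.+1 + n], which lies
strictly above both [i] and [n], so that the levels below [n] need no separate
treatment. *)
Lemma coord_surj n (v : S n) : exists x, coord x n = v.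
Proof.
pose sec k (u : S k) : S k.+1 := sval (cid (bond_surj u)).
have secK k (u : S k) : bond (sec k u) = u by rewrite /sec; case: cid.
pose up := fix up k : S (k + n) :=
  if k is k'.+1 then sec _ (up k') else v.
have lt i : i < i.+1 + n by rewrite ltnS leq_addr.
pose z i := bonds (lt i) (up i.+1).
have zL : limit_set (z : prod_topology (fun n => discrete_topology (S n))).
  move=> i; rewrite /z /= -(bonds_left (ltnW (lt i.+1))) (bonds_step (lt i)).
  by rewrite secK.
have upK k (nk : n < k.+1 + n) : bonds nk (up k.+1) = v.
  elim: k nk => [|k IH] nk; first by rewrite bondsS secK.
  have nk' : n < k.+1 + n by rewrite addSn ltnS leq_addl.
  by rewrite (bonds_step nk') secK.
exists (exist _ (z : prod_topology _) (mem_set zL)).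
exact: upK.
Qed.

Lemma continuous_coord n :
  continuous (fun x => coord x n : discrete_topology (S n)).
Proof.
move=> x; apply: (@continuous_comp (limit S)
  (prod_topology (fun n => discrete_topology (S n))) _ set_val (@proj _ _ n)).
  exact: initial_continuous.
exact: proj_continuous.
Qed.

Lemma open_cylinder n (v : S n) : open [set x : limit S | coord x n = v].
Proof.
apply: (@open_comp _ _ (fun x => coord x n : discrete_topology (S n)) [set v]).
  by move=> x _; exact: continuous_coord.
exact: discrete_open.
Qed.

(** The compatibility of coordinates lets a single coordinate replace the
finitely many ones that describe a neighbourhood in the product topology. *)
Lemma nbhs_cylinder x (A : set (limit S)) :
  nbhs x A <-> exists n, [set y | coord y n = coord x n] `<=` A.
Proof.
split=> [|[n]]; last first.
  move/filterS; apply; apply: open_nbhs_nbhs.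
  by split=> //; exact: open_cylinder.
have coord_le i j y : i <= j -> coord y j = coord x j -> coord y i = coord x i.
  rewrite leq_eqVlt => /orP[/eqP <- //|ij yx].
  by rewrite -!(coord_bonds ij) yx.
pose F : set_system (prod_topology (fun n => discrete_topology (S n))) :=
  filter_from [set: nat]
    (fun n => set_val @` [set y : limit S | coord y n = coord x n]).
have FF : Filter F.
  apply: filter_from_filter => [|i j _ _]; first by exists 0.
  exists (maxn i j) => // _ [y yx <-].
  by split; exists y => //; apply: coord_le yx; rewrite ?leq_maxl ?leq_maxr.
have Fx : F --> (set_val x : prod_topology _).
  apply/cvg_sup => i B [_ [[V opV <-] Vx] VB].
  exists i => // _ [y yx <-]; apply: VB.
  by rewrite /= -[_ i]/(coord y i) yx.
move=> [_ [[V opV <-] Vx] VA].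
have [n _ nV] : F V by apply: Fx; apply: open_nbhs_nbhs.
by exists n => y yx; apply: VA; apply: nV; exists y.
Qed.

Lemma limit_map_edge x n :
  (coord x n, coord (limit_map x) n) \in edges (S n).
Proof. by have /limit_mapP := erefl (limit_map x); apply. Qed.

(** Any edge out of [coord x n.+1] computes the coordinate [n] of the image of
[x]; with [v] the coordinate of the image itself, this gives the continuity of
[limit_map]. *)
Lemma coord_limit_map x n (u v : S n.+1) : coord x n.+1 = u ->
  (u, v) \in edges (S n.+1) -> coord (limit_map x) n = bond v.
Proof.
move=> <- uv; have [_ _ dir] := bond_cover S n.
by rewrite coord_bond; apply: dir (limit_map_edge x n.+1) uv.
Qed.

Lemma limit_map_continuous : continuous (@limit_map S).
Proof.
move=> x A /nbhs_cylinder[n nA]; apply/nbhs_cylinder; exists n.+1 => y yx.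
apply: nA => /=; rewrite (coord_limit_map yx (limit_map_edge x _)).
by rewrite -coord_bond.
Qed.

(** After [i] steps the walk and the orbit may have separated in the top
levels, but they still agree below level [m - i]: [coord_limit_map] loses one
level at each step. *)
Lemma walk_shadow m (w : seq (S m)) (u0 : S m) x :
  sorted (fun u v => (u, v) \in edges (S m)) w -> coord x m = head u0 w ->
  forall i n (nm : n < m), i < size w -> n + i < m ->
  bonds nm (nth u0 w i) = coord (iter i (@limit_map S) x) n.
Proof.
move=> /(sortedP u0) we xw; elim=> [|i IH] n nm il nim.
  by rewrite nth0 -xw coord_bonds.
have n1m : n.+1 < m by rewrite (leq_ltn_trans _ nim) // addnS ltnS leq_addr.
rewrite (bonds_left nm n1m) iterS; apply/esym/coord_limit_map.
  by apply/esym/(IH _ n1m); rewrite ?addSnnS // ltnW.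
exact/edge_bonds/we.
Qed.

End Limit.

(** * Walks and circuits *)

Section Walks.
Variable S : cover_seq.
Implicit Types n m l : nat.

Notation edge := (fun u v => (u, v) \in edges _).

Lemma walk_successor (T : eqType) (x u : T) (s : seq T) :
  u \in belast x s -> exists2 v, v \in s & (u, v) \in zip (x :: s) s.
Proof.
elim: s x => // y s IH x; rewrite /= !inE => /orP[/eqP ->|/IH[v vs uv]].
  by exists y; rewrite ?inE eqxx.
by exists v; rewrite inE ?vs ?uv orbT.
Qed.

Lemma walk_edges_sub (G : graph) (w : seq G) :
  sorted edge w -> walk_edges w \subset edges G.
Proof.
case: w => [_|x s /= xs]; apply/fintype.subsetP => e; rewrite inE //=.
elim: s x xs => //= y s IH x /andP[xy ys]; rewrite inE => /orP[/eqP -> //|].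
exact: IH.
Qed.

Lemma walk_edges_fst (G : graph) (w : seq G) e :
  e \in walk_edges w -> e.1 \in walk_vertices w.
Proof.
case: e => u v; rewrite !inE /=; elim: w (behead w) => [|a s IH] [|b t] //=.
by rewrite !inE => /orP[/eqP[-> _]|/IH ->]; rewrite ?eqxx ?orbT.
Qed.

Lemma walk_within (G : graph) (A : {set G}) x l :
  (forall u, u \in A -> exists2 v, v \in A & (u, v) \in edges G) -> x \in A ->
  exists s, [/\ size s = l, path edge x s & {subset s <= A}].
Proof.
move=> succA; elim: l x => [|l IH] x xA; first by exists [::].
have [v vA xv] := succA x xA; have [s [<- vs sA]] := IH v vA.
exists (v :: s); split=> //=; first by rewrite xv.
by move=> u; rewrite inE => /orP[/eqP -> //|/sA].
Qed.

(** At the last vertex of [s] that is repeated later, the segment up to its next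
occurrence has no other repetition. *)
Lemma sorted_circuit (T : eqType) (e : rel T) (s : seq T) :
  sorted e s -> ~~ uniq s ->
  exists x p, [/\ path e x (rcons p x), uniq (x :: p) & {subset x :: p <= s}].
Proof.
elim: s => // a s IH as_.
have ss : sorted e s by apply: path_sorted as_.
rewrite /= negb_and negbK; have [us|/IH - /(_ ss)[x [p [xp up ps]]] _] :=
  boolP (uniq s); last first.
  by exists x, p; split=> // u /ps us; rewrite inE us orbT.
rewrite orbF => as'; case/splitPr: as' us as_ {ss IH} => p1 p2.
rewrite /= cat_path cat_uniq /= => /and3P[up1 ap1 _] /and3P[ep1 ea _].
exists a, p1; split=> /=.
- by rewrite rcons_path ep1.
- by rewrite up1 andbT; case/norP: ap1.
- by move=> u; rewrite !inE mem_cat => /orP[] ->; rewrite ?orbT.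
Qed.

Lemma Circ_closed_path (G : graph) (x : G) p :
  path edge x (rcons p x) -> uniq (x :: p) ->
  let w := x :: rcons p x in Circ G (walk_vertices w, walk_edges w).
Proof.
move=> xp up w.
have sw : size w == (size p).+2 by rewrite /= size_rcons.
exists (size p).+1, (Tuple sw); split=> //; split=> //.
- by rewrite inE.
- by rewrite !(tnth_nth x) /= nth_rcons ltnn eqxx.
- by rewrite /= -cats1 takel_cat // take_size.
Qed.

Lemma circuit_successor (G : graph) l (w : l.+1.-tuple G) u :
  is_circuit w -> u \in (w : seq G) ->
  exists2 v, v \in (w : seq G) & (u, v) \in walk_edges w.
Proof.
case: l w => [|l] w [] // _ _; case: w => [[|x [|y s]]] //= sw.
rewrite !(tnth_nth x) /=; move: (sw); rewrite eqSS => /eqP[sl].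
rewrite -sl nth_last /= => xl _ uw.
have ub : u \in belast x (y :: s).
  move: uw; rewrite [x :: _]lastI mem_rcons inE => /orP[/eqP -> /=|//].
  by rewrite -xl inE eqxx.
have [v vs uv] := walk_successor ub.
by exists v; rewrite inE ?vs ?orbT // uv.
Qed.

(** +Directionality trades one level for the passage from vertices to edges: the
edge of [B] that starts over [a] ends over a successor of [a], and all the
successors of [a] have the same image one level below. *)
Lemma edges_at_full n m (nm : n < m) (n1m : n.+1 < m)
    (A : {set S m}) (B : {set S m * S m}) :
  B \subset edges (S m) ->
  (forall u, u \in A -> exists v, (u, v) \in B) ->
  vertices_at n1m A = [set: S n.+1]%SET -> edges_at nm B = edges (S n).
Proof.
move=> /fintype.subsetP BE succA Afull.
apply/setP/subset_eqP/andP; split; apply/fintype.subsetP.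
  by move=> _ /imsetP[[u v] /BE uv ->]; exact: edge_bonds.
have [_ <- dir] := bond_cover S n; move=> _ /imsetP[[a b] ab ->].
have : a \in vertices_at n1m A by rewrite Afull inE.
move=> /imsetP[u uA aE]; have [v uv] := succA u uA.
apply/imsetP; exists (u, v) => //.
rewrite /edge_map /= !(bonds_left nm n1m) -aE; congr (_, _).
by apply: dir ab _; rewrite aE; apply/edge_bonds/BE.
Qed.

Lemma vertices_at_full n m (nm : n < m) (A : {set S m}) (B : {set S m * S m}) :
  (forall e, e \in B -> e.1 \in A) ->
  edges_at nm B = edges (S n) -> vertices_at nm A = [set: S n]%SET.
Proof.
move=> BA BE; apply/setP => a; rewrite inE.
have [_ [b]] := edges_surj a; rewrite -BE => /imsetP[e eB [-> _]].
exact/imset_f/BA.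
Qed.

Definition walks_visit_all n m (nm : n < m) l :=
  forall w : l.+1.-tuple (S m), w \in walks (S m) l ->
  vertices_at nm (walk_vertices w) = [set: S n]%SET.

Lemma walks_visit_allP n m (nm : n < m) l (w : seq (S m)) :
  walks_visit_all nm l -> sorted edge w -> size w = l.+1 ->
  vertices_at nm (walk_vertices w) = [set: S n]%SET.
Proof. by move=> visit sw /eqP lw; apply: (visit (Tuple lw)); rewrite inE. Qed.

(** The last vertex of a walk has no following edge, hence the walk is one step
longer than those that visit all the vertices. *)
Lemma walk_edges_full n m (nm : n < m) (n1m : n.+1 < m) l
    (w : l.+2.-tuple (S m)) :
  walks_visit_all n1m l -> w \in walks (S m) l.+1 ->
  edges_at nm (walk_edges w) = edges (S n).
Proof.
move=> visit; rewrite inE; case: w => [[|x s]] //= sw xs.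
pose w' := belast x s.
apply: (@edges_at_full n m nm n1m (walk_vertices w')).
- exact: walk_edges_sub.
- move=> u; rewrite inE => /walk_successor[v _ uv].
  by exists v; rewrite inE.
apply: walks_visit_allP visit _ _; last first.
  by rewrite size_belast; apply/eqP.
have : sorted edge (rcons w' (last x s)) by rewrite -lastI.
by case: (w') => //= a p; rewrite rcons_path => /andP[].
Qed.

End Walks.

(** * The equivalence *)

Section Equivalence.
Variable S : cover_seq.
Implicit Types n m l : nat.

(** The bound [n + l < m] leaves enough levels above [n] for [walk_shadow] to
identify the whole walk with an orbit segment in level [n]. *)
Lemma minimal_walks_visit_all n :
  compact [set: limit S] -> hausdorff_space (limit S) ->
  minimal (@limit_map S) ->
  exists l, forall m (nm : n < m), n + l < m -> walks_visit_all S nm l.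
Proof.
move=> cX hX minX.
have return_time (v : S n) : exists l, forall x : limit S,
    exists2 i, i <= l & coord (iter i (@limit_map S) x) n = v.
  apply: (minimal_return_bounded cX hX (@limit_map_continuous S)
    (U := [set x | coord x n = v])) => //; first exact: open_cylinder.
  exact: coord_surj.
pose l := \max_(v : S n) sval (cid (return_time v)).
exists l => m nm nlm w; rewrite inE => we.
have [x xw] := coord_surj (thead w).
apply/setP => v; rewrite [RHS]inE.
have lv : sval (cid (return_time v)) <= l by exact: leq_bigmax.
case: (cid _) lv => lv /= /(_ x)[i il iv] lvl.
have {}il : i <= l by apply: leq_trans lvl.
have xh : coord x m = head (thead w) w by rewrite xw; case/tupleP: w {we xw}.
rewrite -iv -(walk_shadow we xh nm) ?size_tuple //; last first.
  by apply: leq_ltn_trans nlm; rewrite leq_add2l.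
by apply: imset_f; rewrite inE mem_nth ?size_tuple.
Qed.

(** An orbit in a proper closed invariant set [Y] avoids some cylinder disjoint
from [Y], while its trace in level [m] is a walk as long as desired. *)
Lemma walks_visit_all_minimal :
  (forall n, exists m (nm : n < m) l, walks_visit_all S nm l) ->
  minimal (@limit_map S).
Proof.
move=> visit [Y [clY [y Yy] [_ nYX] fY]]; apply: nYX => x _.
apply: contrapT => nYx.
have [n nY] : exists n, [set z | coord z n = coord x n] `<=` ~` Y.
  by apply/nbhs_cylinder/open_nbhs_nbhs; split=> //; exact: closed_openC.
have [m [nm [l visit_l]]] := visit n.
have Yf i z : Y z -> Y (iter i (@limit_map S) z).
  by elim: i => //= i IH /IH Yz; rewrite -fY; exists (iter i (@limit_map S) z).
pose w := [seq coord z m | z <- traject (@limit_map S) y l.+1].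
have we : sorted (fun u v => (u, v) \in edges (S m)) w.
  rewrite sorted_map; apply: (@sub_sorted _ (frel (@limit_map S))).
    by move=> z _ /= /eqP <-; exact: limit_map_edge.
  exact: fpath_traject.
have := walks_visit_allP visit_l we; rewrite size_map size_traject.
move=> /(_ erefl)/setP/(_ (coord x n)); rewrite inE => /imsetP[u].
rewrite inE => /mapP[z /trajectP[i _ ->] ->]; rewrite coord_bonds => zx.
exact: (nY (iter i (@limit_map S) y) (esym zx)) (Yf i y Yy).
Qed.

(** A walk of length [#|S m|] has one vertex more than the graph, so it repeats a
vertex and contains a circuit. *)
Lemma circuits_walks_visit_all n m (nm : n < m) :
  (forall c, Circ (S m) c -> vertices_at nm c.1 = [set: S n]%SET) ->
  walks_visit_all S nm #|S m|.
Proof.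
move=> circ w; rewrite inE => we.
have nuniq : ~~ uniq w.
  apply: contraTN (max_card [in w]) => /card_uniqP ->.
  by rewrite size_tuple ltnn.
have [x [p [xp up pw]]] := sorted_circuit we nuniq.
apply/eqP; rewrite finset.eqEsubset finset.subsetT.
rewrite -(circ _ (Circ_closed_path xp up)) /=.
apply/imsetS/fintype.subsetP => u; rewrite !inE mem_rcons => ux.
by apply: pw; move: ux; rewrite !inE orbA orbb.
Qed.

(** Every vertex of a circuit has a successor in the circuit, so a walk of length
[l] fits inside it; the vertices of the circuit then cover level [n.+1], and its
edges cover level [n]. *)
Lemma walks_visit_all_circuit_edges n m (nm : n < m) (n1m : n.+1 < m) l c :
  walks_visit_all S n1m l -> Circ (S m) c -> edges_at nm c.2 = edges (S n).
Proof.
move=> visit [k [w [cw ->]]] /=.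
have we : walk_edges w \subset edges (S m).
  by apply: walk_edges_sub; case: cw => _; rewrite inE.
apply: (@edges_at_full S n m nm n1m (walk_vertices w)) => //.
  move=> u; rewrite inE => /(circuit_successor cw)[v _ uv].
  by exists v.
have succ u : u \in walk_vertices w ->
    exists2 v, v \in walk_vertices w & (u, v) \in edges (S m).
  rewrite inE => /(circuit_successor cw)[v vw uv].
  by exists v; [rewrite inE | apply: (fintype.subsetP we)].
have hw : thead w \in walk_vertices w by rewrite inE mem_tnth.
have [s [sl ws sw]] := walk_within l succ hw.
apply/eqP; rewrite finset.eqEsubset finset.subsetT.
rewrite -(walks_visit_allP visit (w := thead w :: s)) //= ?sl //.
apply/imsetS/fintype.subsetP => u; rewrite inE inE => /orP[/eqP -> //|].
exact: sw.
Qed.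

End Equivalence.

Theorem theorem3p5 (S : cover_seq)
    (limit_cantor : homeomorphic (limit S) cantor_space) :
  [<-> minimal (@limit_map S);
    forall n : nat, exists (N : nat) (nN : n < N) (l : nat), 1 <= l /\
      forall (m : nat) (Nm : N <= m) (w : l.+1.-tuple (S m)),
        w \in walks (S m) l ->
        edges_at (leq_trans nN Nm) (walk_edges w) = edges (S n);
    forall n : nat, exists (N : nat) (nN : n < N) (l : nat), 1 <= l /\
      forall (m : nat) (Nm : N <= m) (w : l.+1.-tuple (S m)),
        w \in walks (S m) l ->
        vertices_at (leq_trans nN Nm) (walk_vertices w) = [set: S n]%SET;
    forall n : nat, exists (N : nat) (nN : n < N),
      forall (m : nat) (Nm : N <= m) (c : {set S m} * {set S m * S m}),
        Circ (S m) c ->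
        edges_at (leq_trans nN Nm) c.2 = edges (S n);
    forall n : nat, exists (N : nat) (nN : n < N),
      forall (m : nat) (Nm : N <= m) (c : {set S m} * {set S m * S m}),
        Circ (S m) c ->
        vertices_at (leq_trans nN Nm) c.1 = [set: S n]%SET;
    forall n : nat, exists (N : nat) (nN : n < N),
      forall (m : nat) (Nm : N <= m), exists lm : nat, 1 <= lm /\
        forall w : lm.+1.-tuple (S m), w \in walks (S m) lm ->
          edges_at (leq_trans nN Nm) (walk_edges w) = edges (S n);
    forall n : nat, exists (N : nat) (nN : n < N),
      forall (m : nat) (Nm : N <= m), exists lm : nat, 1 <= lm /\
        forall w : lm.+1.-tuple (S m), w \in walks (S m) lm ->
          vertices_at (leq_trans nN Nm) (walk_vertices w) = [set: S n]%SET].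
Proof.
have [cX hX] := homeomorphic_compact_hausdorff limit_cantor
  cantor_space_compact cantor_space_hausdorff.
tfae.
- move=> minX n; have [l visit] := minimal_walks_visit_all n.+1 cX hX minX.
  have lt : n.+1 < (n.+1 + l).+1 by rewrite ltnS leq_addr.
  exists (n.+1 + l).+1, (ltnW lt), l.+1; split=> // m Nm w ww.
  by apply: (@walk_edges_full _ n m _ (leq_trans lt Nm) l) ww; apply: visit.
- move=> walkE n; have [N [nN [l [l1 trav]]]] := walkE n.
  exists N, nN, l; split=> // m Nm w ww.
  exact: vertices_at_full (@walk_edges_fst _ w) (trav m Nm w ww).
- move=> walkV n; have [N [nN [l [_ visit]]]] := walkV n.+1.
  exists N, (ltnW nN) => m Nm c.
  exact: walks_visit_all_circuit_edges (visit m Nm).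
- move=> circE n; have [N [nN trav]] := circE n.
  exists N, nN => m Nm c cc; apply: vertices_at_full (trav m Nm c cc).
  by case: cc => k [w [_ ->]]; exact: walk_edges_fst.
- move=> circV n; have [N [nN visit]] := circV n.+1.
  exists N, (ltnW nN) => m Nm; exists #|S m|.+1; split=> // w.
  apply: (@walk_edges_full S n m _ (leq_trans nN Nm)).
  exact: circuits_walks_visit_all (visit m Nm).
- move=> walkE n; have [N [nN trav]] := walkE n.
  exists N, nN => m Nm; have [l [l1 trav_l]] := trav m Nm.
  exists l; split=> // w ww.
  exact: vertices_at_full (@walk_edges_fst _ w) (trav_l w ww).
move=> walkV; apply: walks_visit_all_minimal => n.
have [N [nN visit]] := walkV n; have [l [_ visit_l]] := visit N (leqnn N).
by exists N, (leq_trans nN (leqnn N)), l.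
Qed.
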